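(* Let $(R,\mathfrak{m},k)$ be a Cohen-Macaulay ring. If $\dim R=1$, then $\varinjlim \mathrm{CM}(R)$ and $\mathrm{CohCM}(R)$ coincide. If $R$ also admits a canonical module, then $\varinjlim \mathrm{CM}(R)=\mathrm{CohCM}(R)$ if and only if $\dim R=1$.
   Context: Cohen-Macaulay rings here are commutative Noetherian local rings, with maximal ideal $\mathfrak{m}$ and residue field $k$, that are Cohen-Macaulay as modules over themselves; write $d=\dim R$ for the Krull dimension. $\mathrm{CM}(R)$ is the class of finitely generated (maximal) Cohen-Macaulay $R$-modules, i.e. finitely generated $M$ with $\mathrm{Ext}_R^i(k,M)=0$ for all $0\le i<d$ (the zero module is included by convention). $\varinjlim\mathrm{CM}(R)$ is the class of all $R$-modules that can be realised as direct limits of directed systems of modules in $\mathrm{CM}(R)$. $\mathrm{CohCM}(R)$ is the class of all (not necessarily finitely generated) $R$-modules $M$ with $\mathrm{Ext}_R^i(k,M)=0$ for all $i<d$. A canonical module is a Cohen-Macaulay $R$-module $\Omega$ with $\dim_k\mathrm{Ext}_R^i(k,\Omega)=0$ for $i\neq d$ and $\dim_k\mathrm{Ext}_R^d(k,\Omega)=1$.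
   Formalization: In the second sentence dim R is assumed positive: for dim R = 0 (for example R a field) both classes consist of all modules, so they coincide although dim R is not 1. *)

(* Defs.v *)
From HB Require Import structures.
From mathcomp Require Import all_boot all_algebra.
From mathcomp Require Import finmap monalg.
From mathcomp Require Import boolp functions.

Set Implicit Arguments.
Unset Strict Implicit.
Unset Printing Implicit Defensive.

Import GRing.Theory.

Local Open Scope ring_scope.

(** * Submodules and quotient modules *)

Section SubmoduleAndQuotient.
Variables (R : nzRingType) (V : lmodType R) (S : submodClosed V).

Record submod := Submod { submod_val : V; _ : submod_val \in S }.

HB.instance Definition _ := [isSub for submod_val].
HB.instance Definition _ := [Choice of submod by <:].
HB.instance Definition _ := [SubChoice_isSubLmodule of submod by <:].

(* [submodClosed] does not inherit from the [zmodClosed] that [Quotient.quot]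
   expects, hence this copy of [S]. *)
Definition submod_zmod : {pred V} := fun x => x \in S.

Lemma submod_zmod_closed : zmod_closed submod_zmod.
Proof.
split=> [|x y Sx Sy]; first exact: (rpred0 S).
by rewrite -scaleN1r; apply: (rpredD Sx); apply: rpredZ.
Qed.

HB.instance Definition _ :=
  GRing.isZmodClosed.Build V submod_zmod submod_zmod_closed.

Definition quotmod : Type := Quotient.quot submod_zmod.

HB.instance Definition _ := GRing.Zmodule.on quotmod.

Definition quotmod_pi (x : V) : quotmod := (\pi_(Quotient.quot submod_zmod) x)%qT.

Lemma quotmod_eqE x y : quotmod_pi x = quotmod_pi y <-> x - y \in S.
Proof.
by split=> [/eqP|Sxy]; last apply/eqP; rewrite -Quotient.idealrBE.
Qed.

Lemma quotmod_surj (u : quotmod) : exists x, u = quotmod_pi x.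
Proof. by exists (repr (u : Quotient.quot submod_zmod)); rewrite /quotmod_pi reprK. Qed.

Definition quotmod_scale (a : R) (u : quotmod) : quotmod :=
  quotmod_pi (a *: repr (u : Quotient.quot submod_zmod)).

Lemma quotmod_scaleE a x :
  quotmod_scale a (quotmod_pi x) = quotmod_pi (a *: x).
Proof.
apply/quotmod_eqE; rewrite -scalerBr; apply: rpredZ.
by apply/quotmod_eqE; rewrite /quotmod_pi reprK.
Qed.

Lemma quotmod_piD : {morph quotmod_pi : x y / x + y}.
Proof. exact: raddfD. Qed.

Fact quotmod_scaleA a b u :
  quotmod_scale a (quotmod_scale b u) = quotmod_scale (a * b) u.
Proof.
by have [x ->] := quotmod_surj u; rewrite !quotmod_scaleE scalerA.
Qed.

Fact quotmod_scale1 : left_id 1 quotmod_scale.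
Proof.
by move=> u; have [x ->] := quotmod_surj u; rewrite quotmod_scaleE scale1r.
Qed.

Fact quotmod_scaleDr : right_distributive quotmod_scale +%R.
Proof.
move=> a u v; have [x ->] := quotmod_surj u; have [y ->] := quotmod_surj v.
by rewrite -quotmod_piD !quotmod_scaleE scalerDr quotmod_piD.
Qed.

Fact quotmod_scaleDl u : {morph quotmod_scale^~ u : a b / a + b}.
Proof.
move=> a b /=; have [x ->] := quotmod_surj u.
by rewrite !quotmod_scaleE scalerDl quotmod_piD.
Qed.

HB.instance Definition _ := GRing.Zmodule_isLmodule.Build R quotmod
  quotmod_scaleA quotmod_scale1 quotmod_scaleDr quotmod_scaleDl.

Fact quotmod_pi_linear : linear quotmod_pi.
Proof. by move=> a x y; rewrite quotmod_piD -quotmod_scaleE. Qed.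

HB.instance Definition _ :=
  GRing.isLinear.Build R V quotmod _ quotmod_pi quotmod_pi_linear.

Lemma quotmod_eq0 x : quotmod_pi x = 0 <-> x \in S.
Proof. by rewrite -(linear0 quotmod_pi) quotmod_eqE subr0. Qed.

End SubmoduleAndQuotient.

Section Kernel.
Variables (R : nzRingType) (U V : lmodType R) (f : {linear U -> V}).

Definition lin_ker : {pred U} := fun x => f x == 0.

Fact lin_ker_submod_closed : submod_closed lin_ker.
Proof.
split=> [|a x y /eqP fx /eqP fy]; first by rewrite unfold_in linear0.
by rewrite unfold_in linearP fx fy scaler0 addr0.
Qed.

HB.instance Definition _ := GRing.isSubmodClosed.Build R U lin_ker lin_ker_submod_closed.

End Kernel.

(** * A functorial free resolution

    [free_mod N] is the free module on the underlying set of [N], and [counit N]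
    is the linear map sending the basis element of [x : N] to [x].  Iterating
    this on kernels, with [syz N 0 = N] and [syz N i.+1] the kernel of
    [counit (syz N i)], yields a free resolution
    [... -> res N 1 -> res N 0 -> N -> 0]. *)

Section FreeResolution.
Variable R : comNzRingType.
Implicit Types N : lmodType R.

Definition free_mod N : lmodType R := {malg R[N]}.

Definition counit N (g : free_mod N) : N := \sum_(x <- msupp g) g@_x *: x.

Fact counitEw N (g : free_mod N) (D : {fset N}) :
  (msupp g `<=` D)%fset -> counit g = \sum_(x <- D) g@_x *: x.
Proof.
move=> gD; rewrite [LHS](big_fset_incl _ gD) // => x _ /mcoeff_outdom ->.
exact: scale0r.
Qed.

Fact counit_linear N : linear (@counit N).
Proof.
move=> a g h; pose D := (msupp g `|` msupp h `|` msupp (a *: g + h))%fset.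
rewrite (@counitEw _ (a *: g + h) D) ?fsubsetUr //.
rewrite (@counitEw _ g D); last by rewrite /D -fsetUA fsubsetUl.
rewrite (@counitEw _ h D); last by rewrite /D fsetUAC fsubsetUr.
rewrite scaler_sumr -big_split /=; apply: eq_bigr => x _.
by rewrite mcoeffD mcoeffZ scalerDl scalerA.
Qed.

HB.instance Definition _ N :=
  GRing.isLinear.Build R (free_mod N) N _ (@counit N) (@counit_linear N).

Fixpoint syz N (i : nat) : lmodType R :=
  if i is j.+1 then submod (lin_ker (@counit (syz N j))) else N.

Definition res N i : lmodType R := free_mod (syz N i).

Definition res_d N i (g : res N i.+1) : res N i :=
  submod_val (counit g : submod (lin_ker (@counit (syz N i)))).

Fact res_d_linear N i : linear (@res_d N i).
Proof. by move=> a g h; rewrite /res_d !linearP. Qed.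

HB.instance Definition _ N i :=
  GRing.isLinear.Build R (res N i.+1) (res N i) _ (@res_d N i)
    (@res_d_linear N i).

Lemma counit_surj N (x : N) : exists g : free_mod N, counit g = x.
Proof.
exists (mkmalgU x 1 : {malg R[N]}).
by rewrite (counitEw msuppU_le) big_seq_fset1 mcoeffUU scale1r.
Qed.

Lemma res_exact N i (g : res N i) :
  counit g = 0 <-> exists h : res N i.+1, g = res_d h.
Proof.
split=> [g0 | [h ->]]; last first.
  by rewrite /res_d; case: (counit h) => x /= /eqP.
have kg : g \in lin_ker (@counit (syz N i)) by apply/eqP.
have [h hE] := @counit_surj (syz N i.+1) (Submod kg).
by exists h; rewrite /res_d hE.
Qed.

End FreeResolution.

(** * Ext

    [Ext i N M] is the [i]-th cohomology module of the complex of linear maps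
    from [res N] to [M]. *)

Section Ext.
Variables (R : comNzRingType) (N M : lmodType R).

Definition cocycle i : {pred res N i -> M} := fun f =>
  `[< linear f /\ forall g : res N i.+1, f (res_d g) = 0 >].

Fact cocycle_submod_closed i : submod_closed (@cocycle i).
Proof.
split=> [|a f g /asboolP[fl f0] /asboolP[gl g0]]; apply/asboolP.
  by split=> // b x y; rewrite scaler0 addr0.
split=> [b x y|x]; last by rewrite -[LHS]/(a *: f _ + g _) f0 g0 scaler0 addr0.
rewrite -[LHS]/(a *: f _ + g _) -[RHS]/(b *: (a *: f x + g x) + (a *: f y + g y)).
by rewrite fl gl !scalerDr !scalerA [a * b]mulrC !addrA; congr (_ + _); rewrite addrAC.
Qed.

HB.instance Definition _ i :=
  GRing.isSubmodClosed.Build R (res N i -> M) (@cocycle i)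
    (@cocycle_submod_closed i).

Definition is_coboundary i : (res N i -> M) -> Prop :=
  if i is j.+1 return (res N i -> M) -> Prop then
    fun f => exists h : {linear res N j -> M}, forall g, f g = h (res_d g)
  else fun f => forall g, f g = 0.

Definition coboundary i : {pred submod (@cocycle i)} := fun f =>
  `[< is_coboundary (submod_val f) >].

Fact coboundary_submod_closed i : submod_closed (@coboundary i).
Proof.
case: i => [|i]; split=> [|a f g /asboolP fB /asboolP gB]; apply/asboolP => //=.
- by move=> x; rewrite -[LHS]/(a *: submod_val f x + submod_val g x) fB gB scaler0 addr0.
- by exists (\0 : {linear res N i -> M}).
have [h hE] := fB; have [k kE] := gB; exists (a \*: h \+ k) => x /=.
by rewrite -[LHS]/(a *: submod_val f x + submod_val g x) hE kE.
Qed.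

HB.instance Definition _ i :=
  GRing.isSubmodClosed.Build R (submod (@cocycle i)) (@coboundary i)
    (@coboundary_submod_closed i).

End Ext.

Definition Ext (R : comNzRingType) (i : nat) (N M : lmodType R) : lmodType R :=
  quotmod (@coboundary R N M i).

Definition trivial_module (R : nzRingType) (M : lmodType R) : Prop :=
  forall x : M, x = 0.

(** * Noetherian local rings *)

Definition fin_gen (R : nzRingType) (M : lmodType R) : Prop :=
  exists (n : nat) (e : 'I_n -> M),
    forall x, exists c : 'I_n -> R, x = \sum_i c i *: e i.

(* Ideals are the submodules of [R^o]: unlike [idealr], which is reserved for
   proper ideals, this includes the unit ideal. *)
Definition noetherian (R : comNzRingType) : Prop :=
  forall I : submodClosed R^o, fin_gen (submod I).

Definition maximal_ideal (R : comNzRingType) (m : idealr R) : Prop :=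
  forall I : idealr R, {subset m <= I} -> {subset I <= m}.

Definition local_ring (R : comNzRingType) (m : idealr R) : Prop :=
  maximal_ideal m /\ forall I : idealr R, maximal_ideal I -> I =i m.

Definition prime_chain (R : comNzRingType) (n : nat) : Prop :=
  exists p : 'I_n.+1 -> prime_idealr R, forall i j : 'I_n.+1, (i < j)%N ->
    {subset p i <= p j} /\ ~ {subset p j <= p i}.

Definition krull_dim (R : comNzRingType) (d : nat) : Prop :=
  prime_chain R d /\ forall n, prime_chain R n -> (n <= d)%N.

Section ResidueField.
Variables (R : comNzRingType) (m : idealr R).

Definition idealr_submod : {pred R^o} := fun x => x \in m.

Fact idealr_submod_closed : submod_closed idealr_submod.
Proof.
split=> [|a x y xm ym]; first exact: idealr0.
by apply: rpredD => //; apply: idealMr.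
Qed.

HB.instance Definition _ :=
  GRing.isSubmodClosed.Build R R^o idealr_submod idealr_submod_closed.

Definition residue : lmodType R := quotmod idealr_submod.

(* [dim_k E = n] for an [R]-module [E] killed by [m], i.e. a vector space over
   [k = R/m]: the family [e] is a basis, its coefficients in [k] being given by
   representatives in [R]. *)
Definition residue_dim (E : lmodType R) (n : nat) : Prop :=
  (forall a, a \in m -> forall x : E, a *: x = 0) /\
  exists e : 'I_n -> E,
    (forall x, exists c : 'I_n -> R, x = \sum_i c i *: e i) /\
    (forall c : 'I_n -> R, \sum_i c i *: e i = 0 -> forall i, c i \in m).

End ResidueField.

(** * Direct limits *)

Record directed_system (R : nzRingType) := DirectedSystem {
  ds_index : Type;
  ds_le : ds_index -> ds_index -> Prop;
  ds_inhabited : inhabited ds_index;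
  ds_refl : forall i, ds_le i i;
  ds_trans : forall i j k, ds_le i j -> ds_le j k -> ds_le i k;
  ds_directed : forall i j, exists k, ds_le i k /\ ds_le j k;
  ds_module : ds_index -> lmodType R;
  ds_map : forall i j, ds_le i j -> {linear ds_module i -> ds_module j};
  ds_map_id : forall i (ii : ds_le i i) x, ds_map ii x = x;
  ds_map_comp : forall i j k (ij : ds_le i j) (jk : ds_le j k) (ik : ds_le i k) x,
    ds_map jk (ds_map ij x) = ds_map ik x
}.

Arguments ds_module [R] D i : rename.

Definition cocone (R : nzRingType) (D : directed_system R) (M : lmodType R)
    (u : forall i, {linear ds_module D i -> M}) : Prop :=
  forall i j (ij : ds_le i j) x, u j (ds_map ij x) = u i x.

Definition is_direct_limit (R : nzRingType) (D : directed_system R)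
    (M : lmodType R) (u : forall i, {linear ds_module D i -> M}) : Prop :=
  cocone u /\
  forall (N : lmodType R) (v : forall i, {linear ds_module D i -> N}), cocone v ->
    exists g : {linear M -> N},
      (forall i x, g (u i x) = v i x) /\
      forall h : {linear M -> N}, (forall i x, h (u i x) = v i x) -> h =1 g.

(** * Cohen-Macaulay rings and modules

    Throughout, [m] is the maximal ideal and [d] the Krull dimension of [R]. *)

Section CohenMacaulay.
Variables (R : comNzRingType) (m : idealr R) (d : nat).
Implicit Types M : lmodType R.

Definition CohCM M : Prop :=
  forall i, (i < d)%N -> trivial_module (Ext i (residue m) M).

Definition CM M : Prop := fin_gen M /\ CohCM M.

Definition lim_CM M : Prop :=
  exists (D : directed_system R) (u : forall i, {linear ds_module D i -> M}),
    is_direct_limit u /\ forall i, CM (ds_module D i).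

Definition canonical_module (Omega : lmodType R) : Prop :=
  [/\ CM Omega,
      forall i, i <> d -> residue_dim m (Ext i (residue m) Omega) 0
    & residue_dim m (Ext d (residue m) Omega) 1].

Record CM_local_ring : Prop := {
  CM_local_noetherian : noetherian R;
  CM_local_local : local_ring m;
  CM_local_dim : krull_dim R d;
  CM_local_CM : CM R^o
}.

End CohenMacaulay.

(* Main.v *)
(** In a direct limit of modules [M_i], an element killed by a finitely generated
ideal lifts to an element of some [M_i] killed by the same ideal.

If [d = 1], [CohCM] only asks that no nonzero element be killed by [m].  This
property is inherited by direct limits, by the above, and by finitely generated
submodules, of which every module is the direct limit.

If [d > 1], pick primes [p0 < p1 < p2] and [s] in [p2] but not in [p1].  On
[M = (R/p1)[1/s]] the element [s] of [m] is bijective while it kills the residue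
field [k], so all [Ext^i(k, M)] vanish.  Were [M] in [lim CM], some
Cohen-Macaulay module would have a nonzero element killed by [p1].  But the
annihilator of a nonzero element of such a module lies in the bottom prime of a
chain of length [d] (depth is at most [dim R/q] for every associated prime [q]),
and [p0] would extend that chain to length [d + 1]. *)

Require Import Defs.
From HB Require Import structures.
From mathcomp Require Import all_boot all_algebra.
From mathcomp Require Import finmap monalg.
From mathcomp Require Import boolp functions.

Set Implicit Arguments.
Unset Strict Implicit.
Unset Printing Implicit Defensive.

Import GRing.Theory.

Local Open Scope ring_scope.

(** * Submodules and Noetherian modules *)

Section Packaging.
Variables (R : nzRingType) (U V : lmodType R).

Lemma linear_exists (f : U -> V) : linear f -> exists g : {linear U -> V}, g =1 f.
Proof.
move=> lf.
pose mf := GRing.isLinear.Build R U V _ f lf.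
pose g : {linear U -> V} := HB.pack f mf.
by exists g.
Qed.

(** [Prop]-valued predicates allow existential descriptions of submodules; [submod_exists]
    repackages one when a quotient is formed. *)
Definition submoduleP (P : V -> Prop) : Prop :=
  P 0 /\ forall a x y, P x -> P y -> P (a *: x + y).

Lemma submod_exists (P : V -> Prop) : submoduleP P ->
  exists S : submodClosed V, forall x, x \in S <-> P x.
Proof.
move=> [P0 PD].
have cP : submod_closed (fun x => `[< P x >]).
  by split=> [|a x y /asboolP Px /asboolP Py]; apply/asboolP => //; apply: PD.
pose mP := GRing.isSubmodClosed.Build R V (fun x => `[< P x >]) cP.
pose S : submodClosed V := HB.pack (fun x => `[< P x >]) mP.
by exists S => x; split=> /asboolP.
Qed.

Section SubmoduleTheory.
Variables (P : V -> Prop) (hP : submoduleP P).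
Lemma submoduleZ a x : P x -> P (a *: x).
Proof. by move=> Px; rewrite -[_ *: _]addr0; apply: hP.2 => //; case: hP. Qed.
Lemma submoduleD x y : P x -> P y -> P (x + y).
Proof. by move=> Px Py; rewrite -[x]scale1r; apply: hP.2. Qed.
Lemma submoduleB x y : P x -> P y -> P (x - y).
Proof. by move=> Px Py; rewrite -scaleN1r addrC; apply: hP.2. Qed.
End SubmoduleTheory.

End Packaging.

Section Ideals.
Variable R : comNzRingType.

Lemma idealr_exists (P : R -> Prop) : @submoduleP R R^o P -> ~ P 1 ->
  exists I : idealr R, forall x, x \in I <-> P x.
Proof.
move=> [P0 PD] P1.
have cP : idealr_closed (fun x => `[< P x >]).
  split=> [||a x y /asboolP Px /asboolP Py]; try apply/asboolP => //.
  exact: PD.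
pose mP := isIdealr.Build R (fun x => `[< P x >]) cP.
pose S : idealr R := HB.pack (fun x : R => `[< P x >]) mP.
by exists S => x; split=> /asboolP.
Qed.

Lemma prime_idealr_exists (P : R -> Prop) : @submoduleP R R^o P -> ~ P 1 ->
  (forall a b, P (a * b) -> P a \/ P b) ->
  exists I : prime_idealr R, forall x, x \in I <-> P x.
Proof.
move=> [P0 PD] P1 Pp.
have cP : idealr_closed (fun x => `[< P x >]).
  split=> [||a x y /asboolP Px /asboolP Py]; try apply/asboolP => //.
  exact: PD.
have pP : prime_idealr_closed (fun x => `[< P x >]).
  by move=> a b /asboolP/Pp[]/asboolP; rewrite /in_mem /= => ->; rewrite ?orbT.
pose mP := isIdealr.Build R (fun x => `[< P x >]) cP.
pose qP := isPrimeIdealrClosed.Build R (fun x => `[< P x >]) pP.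
pose S : prime_idealr R := HB.pack (fun x : R => `[< P x >]) mP qP.
by exists S => x; split=> /asboolP.
Qed.

End Ideals.

Section Span.
Variables (R : comNzRingType) (V : lmodType R).
Implicit Types (L : seq V) (P : V -> Prop).

(** Recursive rather than indexed, so that inductions can peel off one generator. *)
Fixpoint span L (x : V) : Prop :=
  if L is g :: L' then exists a, span L' (x - a *: g) else x = 0.

Lemma span_submodule L : submoduleP (span L).
Proof.
elim: L => [|g L IH] /=; first by split=> // a x y -> ->; rewrite scaler0 addr0.
split=> [|a x y [b xb] [c yc]]; first by exists 0; rewrite scale0r subr0; case: IH.
exists (a * b + c); have := IH.2 a _ _ xb yc.
by rewrite scalerBr scalerDl scalerA opprD addrACA.
Qed.

Lemma span_mem L x : x \in L -> span L x.
Proof.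
elim: L => //= g L IH; rewrite inE => /orP[/eqP->|/IH sx].
  by exists 1; rewrite scale1r subrr; case: (span_submodule L).
by exists 0; rewrite scale0r subr0.
Qed.

Lemma span_min L P : submoduleP P -> (forall x, x \in L -> P x) ->
  forall x, span L x -> P x.
Proof.
move=> hP; elim: L => [_ x ->|g L IH LP x [a sx]]; first by case: hP.
rewrite -[x](subrK (a *: g)); apply: submoduleD => //.
  by apply: IH sx => y yL; apply: LP; rewrite inE yL orbT.
by apply: submoduleZ => //; apply: LP; rewrite mem_head.
Qed.

Lemma span_sub L1 L2 : {subset L1 <= L2} -> forall x, span L1 x -> span L2 x.
Proof. by move=> s12; apply: span_min (span_submodule _) _ => x /s12/span_mem. Qed.

Lemma submoduleI P Q : submoduleP P -> submoduleP Q -> submoduleP (fun x => P x /\ Q x).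
Proof.
by move=> [P0 PD] [Q0 QD]; split=> // a x y [? ?] [? ?]; split; [apply: PD|apply: QD].
Qed.

Lemma span_sum n (e : 'I_n -> V) x :
  span [seq e i | i <- enum 'I_n] x <-> exists c : 'I_n -> R, x = \sum_i c i *: e i.
Proof.
split=> [|[c ->]]; last first.
  elim/big_ind: _ => [|y z|i _]; first by case: (span_submodule [seq e i | i <- enum 'I_n]).
    exact: (submoduleD (span_submodule _)).
  apply: (submoduleZ (span_submodule [seq e i | i <- enum 'I_n])).
  by apply/span_mem/map_f; rewrite mem_enum.
move: x; apply: span_min => [|y /mapP[i _ ->]]; first split.
- by exists (fun=> 0); rewrite big1 // => i _; rewrite scale0r.
- move=> a y z [c ->] [b ->]; exists (fun i => a * c i + b i).
  rewrite scaler_sumr -big_split; apply: eq_bigr => i _ /=.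
  by rewrite scalerDl scalerA.
exists (fun j => (i == j)%:R); rewrite (bigD1 i) //= eqxx scale1r big1 ?addr0 //.
by move=> j; rewrite eq_sym => /negbTE->; rewrite scale0r.
Qed.

Lemma spanP L x :
  span L x <-> exists c : 'I_(size L) -> R, x = \sum_i c i *: L`_i.
Proof.
rewrite -span_sum; split; apply: span_sub => y.
  move=> yL; have lt : (index y L < size L)%N by rewrite index_mem.
  by apply/mapP; exists (Ordinal lt); rewrite ?mem_enum //= nth_index.
by case/mapP=> i _ ->; apply: mem_nth.
Qed.

Lemma fin_genP : fin_gen V <-> exists L, forall x, span L x.
Proof.
split=> [[n [e eV]]|[L LV]].
  by exists [seq e i | i <- enum 'I_n] => x; apply/span_sum.
by exists (size L), (fun i => L`_i) => x; apply/spanP.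
Qed.

Definition finitely_generated P : Prop :=
  exists2 L, (forall x, x \in L -> P x) & forall x, P x -> span L x.

Definition noetherian_module : Prop := forall P, submoduleP P -> finitely_generated P.

End Span.

Lemma noetherianP (R : comNzRingType) : noetherian R -> noetherian_module (R^o : lmodType R).
Proof.
move=> noeR P hP; have [S SP] := submod_exists hP.
have [n [e eS]] := noeR S.
exists [seq submod_val (e i) | i <- enum 'I_n].
  by move=> _ /mapP[i _ ->]; apply/SP; case: (e i).
move=> x /SP xS; apply/span_sum.
have [c /(congr1 (@submod_val _ _ _)) /= xE] := eS (Submod xS).
exists c; rewrite {1}xE; elim/big_rec2: _ => //= i y1 y2 _ <-.
by [].
Qed.

(** Induction on the generators: the coefficients of the first one, [g], in elements of [Q] form an
    ideal [I]. Lifts [B] of generators of [I], together with generators of the part of [Q] in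
    [span G], generate [Q]. *)
Lemma noetherian_fin_gen (R : comNzRingType) (V : lmodType R) :
  noetherian R -> fin_gen V -> noetherian_module V.
Proof.
move=> /noetherianP noeR /fin_genP[G GV] P hP.
suff main : forall Q, submoduleP Q -> (forall x, Q x -> span G x) -> finitely_generated Q.
  exact: main.
clear -noeR; elim: G => [|g G IH] Q hQ QG.
  by exists [::] => // x /QG.
pose I (a : R^o) := exists2 x, span G x & Q (a *: g + x).
have hI : submoduleP I.
  split=> [|a b c [x xG xQ] [y yG yQ]].
    by exists 0; [case: (span_submodule G)|rewrite scale0r addr0; case: hQ].
  exists (a *: x + y); first by case: (span_submodule G) => _; apply.
  by have := hQ.2 a _ _ xQ yQ; rewrite scalerDl scalerDr scalerA addrACA.
have [A AI IA] := noeR _ hI.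
have [L' L'Q QL'] := IH _ (submoduleI hQ (span_submodule G)) (fun x => @proj2 _ _).
have [B BQ AB] : exists2 B, (forall x, x \in B -> Q x) &
    forall a, span A a -> exists2 x, span G x & span B (a *: g + x).
  elim: A AI {IA} => [|a A IHA] AI.
    exists [::] => // a /= ->; exists 0; rewrite ?scale0r ?addr0 //.
    by case: (span_submodule G).
  have [|B BQ AB] := IHA; first by move=> b bA; apply: AI; rewrite inE bA orbT.
  have [x xG xQ] := AI a (mem_head _ _).
  exists (a *: g + x :: B) => [y|b [c /AB[y yG yB]]].
    by rewrite inE => /orP[/eqP->|/BQ].
  exists (c *: x + y); first by case: (span_submodule G) => _; apply.
  exists c; move: yB; congr (span B _).
  by rewrite scalerBl scalerDr scalerA opprD [RHS]addrACA [c *: x + y]addrC addrK.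
exists (B ++ L').
  by move=> x; rewrite mem_cat => /orP[/BQ|/L'Q[]].
move=> x Qx; have [a aG] := QG x Qx.
have /IA/AB[y yG yB] : I a by exists (x - a *: g); rewrite // addrC subrK.
have yQ := span_min hQ BQ yB.
rewrite -[x](subrK (a *: g + y)); apply: (submoduleD (span_submodule (B ++ L'))).
  have /QL' : Q (x - (a *: g + y)) /\ span G (x - (a *: g + y)).
    split; first exact: submoduleB.
    by rewrite opprD addrA; apply: submoduleB => //; apply: span_submodule.
  by apply: span_sub => z zL; rewrite mem_cat zL orbT.
by apply: span_sub yB => z zL; rewrite mem_cat zL.
Qed.

Section NoetherianModules.
Variables (R : comNzRingType) (V : lmodType R).
Hypothesis noeV : noetherian_module V.

(** The ascending chain condition on spans. An inaccessible list could be extended forever by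
    elements outside the current span; the union of these spans is finitely generated, so some stage
    already contains it. *)
Lemma span_extension_wf :
  well_founded (fun L' L : seq V => exists2 z, ~ span L z & L' = z :: L).
Proof.
move=> L0; apply: contrapT => nL0.
pose nacc L := ~ Acc (fun L' L : seq V => exists2 z, ~ span L z & L' = z :: L) L.
have step L : exists z, nacc L -> ~ span L z /\ nacc (z :: L).
  have [aL|nL] := pselect (~ nacc L); first by exists 0 => /aL.
  apply: contrapT => nex; apply: nL => nL; apply: nL; constructor=> _ [w wL ->].
  by apply: contrapT => nw; apply: nex; exists w.
have [f fP] := choice step.
pose s n := iter n (fun L => f L :: L) L0.
have ns n : nacc (s n) by elim: n => //= n /fP[].
have s_mono n k x : span (s n) x -> span (s (k + n)) x.
  by move=> sx; elim: k => //= k IH; exists 0; rewrite scale0r subr0.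
have s_max n k x : (n <= k)%N -> span (s n) x -> span (s k) x.
  by move=> /subnK <-; apply: s_mono.
have hP : submoduleP (fun x => exists n, span (s n) x).
  split=> [|a x y [n nx] [k ky]]; first by exists 0; case: (span_submodule (s 0)).
  exists (maxn n k); apply: (span_submodule _).2.
    exact: s_max (leq_maxl _ _) nx.
  exact: s_max (leq_maxr _ _) ky.
have [G Gs sG] := noeV hP.
have [N GN] : exists N, forall x, x \in G -> span (s N) x.
  elim: G Gs {sG} => [|g G IH] Gs; first by exists 0.
  have [|N NG] := IH; first by move=> x xG; apply: Gs; rewrite inE xG orbT.
  have [n ng] := Gs g (mem_head _ _).
  exists (maxn n N) => x; rewrite inE => /orP[/eqP->|/NG].
    exact: s_max (leq_maxl _ _) ng.
  exact/s_max/leq_maxr.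
have [] := fP _ (ns N); case; apply: (span_min (span_submodule _) GN).
by apply: sG; exists N.+1; apply: span_mem; rewrite mem_head.
Qed.

(** Well-founded induction on a list [L] inside the current candidate [Q]: if [L] spans [Q] and [Q]
    is not maximal, a larger member of [F] supplies a new element for [L]. *)
Lemma maximal_submodule (F : (V -> Prop) -> Prop) P :
  (forall Q, F Q -> submoduleP Q) -> F P ->
  exists Q, [/\ F Q, forall x, P x -> Q x &
    forall Q', F Q' -> (forall x, Q x -> Q' x) -> forall x, Q' x -> Q x].
Proof.
move=> Fsub FP.
suff main (L : seq V) : forall Q, F Q ->
    (forall x, P x -> Q x) -> (forall x, x \in L -> Q x) ->
    exists Q, [/\ F Q, forall x, P x -> Q x &
    forall Q', F Q' -> (forall x, Q x -> Q' x) -> forall x, Q' x -> Q x].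
  by apply: (main [::] P).
elim/(well_founded_ind span_extension_wf): L => L IH Q FQ PQ LQ.
have [[z Qz Lz]|QL] := pselect (exists2 z, Q z & ~ span L z).
  apply: (IH (z :: L) _ Q) => //; first by exists z.
  by move=> x; rewrite inE => /orP[/eqP->|/LQ].
have [[Q' [FQ' [QQ' [z Q'z Qz]]]]|Qmax] := pselect (exists Q', F Q' /\
  ((forall x, Q x -> Q' x) /\ exists2 z, Q' z & ~ Q z)).
  apply: (IH (z :: L) _ Q') => //.
  - by exists z => // Lz; apply: Qz; apply: span_min Lz => //; apply: Fsub.
  - by move=> x /PQ/QQ'.
  by move=> x; rewrite inE => /orP[/eqP->|/LQ/QQ'].
exists Q; split=> // Q' FQ' QQ' x Q'x; apply: contrapT => nQx.
by apply: Qmax; exists Q'; do !split => //; exists x.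
Qed.

End NoetherianModules.

Section LocalRing.
Variables (R : comNzRingType) (m : idealr R).
Hypotheses (noeR : noetherian R) (locR : local_ring m).

(** Otherwise the multiples of [a] form a proper ideal, contained in a maximal one, which can only
    be [m]. *)
Lemma local_unit a : a \notin m -> exists b, b * a = 1.
Proof.
move=> am; apply: contrapT => na.
pose F (J : R^o -> Prop) := submoduleP J /\ ~ J 1.
have [|Q [[hQ Q1] aQ Qmax]] := @maximal_submodule R R^o (noetherianP noeR) F
    (fun x => exists b, b * a = x) (fun Q => @proj1 _ _).
  split=> //; split=> [|c x y [b <-] [b' <-]]; first by exists 0; rewrite mul0r.
  by exists (c * b + b'); rewrite mulrDl -mulrA.
have [I IQ] := idealr_exists hQ Q1.
have maxI : maximal_ideal I.
  move=> J IJ x xJ; apply/IQ; apply: (Qmax (fun x => x \in J)) => //.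
    split; last by rewrite idealr1.
    split=> [|c y z yJ zJ]; first exact: idealr0.
    by rewrite rpredD // idealMr.
  by move=> y /IQ/IJ.
move/negP: am; apply; rewrite -(locR.2 _ maxI); apply/IQ/aQ.
by exists 1; rewrite mul1r.
Qed.

Lemma idealr_sub_local (I : idealr R) : {subset I <= m}.
Proof.
move=> x xI; apply: contraT => /local_unit[b bx1].
by rewrite -(idealr1 I) -bx1 idealMr.
Qed.

End LocalRing.

(** * Associated primes and regular elements *)

Section MaximalAnnihilators.
Variables (R : comNzRingType) (V : lmodType R).
Hypotheses (noeR : noetherian R) (noeV : noetherian_module V).
Implicit Types z w : V.

(** Maximality is among annihilators of nonzero elements, which makes [ann z] an associated prime of
    [V]. *)
Definition maximal_ann z : Prop := z <> 0 /\ forall w, w <> 0 ->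
  (forall a, a *: z = 0 -> a *: w = 0) -> forall a, a *: w = 0 -> a *: z = 0.

Lemma ann_submodule z : @submoduleP R R^o (fun a => a *: z = 0).
Proof.
split=> [|a b c bz cz]; first by rewrite scale0r.
by rewrite scalerDl -scalerA bz cz scaler0 addr0.
Qed.

Lemma maximal_ann_exists z : z <> 0 ->
  exists2 w, maximal_ann w & forall a, a *: z = 0 -> a *: w = 0.
Proof.
move=> z0.
pose F (J : R^o -> Prop) := exists2 w : V, w <> 0 & J = (fun a : R => a *: w = 0).
have [||Q [[w w0 ->] zw wmax]] := @maximal_submodule R R^o (noetherianP noeR) F
    (fun a : R => a *: z = 0).
- by move=> _ [w _ ->]; apply: ann_submodule.
- by exists z.
exists w => //; split=> // v v0 wv.
by apply: (wmax (fun a : R => a *: v = 0)) => //; exists v.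
Qed.

(** If [b z] is nonzero, its annihilator contains [ann z], hence equals it, and [a] kills [b z]. *)
Lemma maximal_ann_prime z a b : maximal_ann z ->
  (a * b) *: z = 0 -> a *: z = 0 \/ b *: z = 0.
Proof.
move=> [z0 zmax] abz; have [|bz] := eqVneq (b *: z) 0; first by right.
left; apply: (zmax (b *: z)); rewrite ?scalerA //; first exact/eqP.
by move=> c cz; rewrite scalerA mulrC -scalerA cz scaler0.
Qed.

Lemma maximal_ann_avoid z (L : seq V) : maximal_ann z ->
  (forall w, w \in L -> exists2 a, a *: w = 0 & a *: z <> 0) ->
  exists2 a, forall w, w \in L -> a *: w = 0 & a *: z <> 0.
Proof.
move=> zmax; elim: L => [|w L IH] LP.
  by exists 1; rewrite ?scale1r //; case: zmax.
have [|a aL az] := IH; first by move=> v vL; apply: LP; rewrite inE vL orbT.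
have [b bw bz] := LP w (mem_head _ _).
exists (a * b) => [v|]; last by case/(maximal_ann_prime zmax).
rewrite inE => /orP[/eqP->|/aL av]; first by rewrite -scalerA bw scaler0.
by rewrite mulrC -scalerA av scaler0.
Qed.

(* Prime avoidance, one prime at a time: an [x] outside finitely many maximal
   annihilators [ann w] is regular or lies in some other [ann z]; in the latter
   case [z] is outside the span of the [w]'s, so the process stops. *)
Lemma regular_element_exists (m : idealr R) :
  (forall y : V, (forall a, a \in m -> a *: y = 0) -> y = 0) ->
  exists2 x, x \in m & forall y : V, x *: y = 0 -> y = 0.
Proof.
move=> socV.
suff main (L : seq V) : (forall w, w \in L -> maximal_ann w) -> forall x, x \in m ->
    (forall w, w \in L -> x *: w <> 0) ->
    exists2 x, x \in m & forall y : V, x *: y = 0 -> y = 0.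
  by apply: (main [::]) (idealr0 m) _.
elim/(well_founded_ind (span_extension_wf noeV)): L => L IH Lmax x xm xL.
have [xreg|] := pselect (forall y : V, x *: y = 0 -> y = 0); first by exists x.
move=> /existsNP[y /not_implyP[xy0 y0]].
have [z zmax yz] := maximal_ann_exists y0.
(* No [ann w] lies in [ann z]: they would be equal by maximality, but [x] kills [z] and not [w]. *)
have [|a aL az] := @maximal_ann_avoid z L zmax.
  move=> w wL; apply: contrapT => nex.
  apply: (xL w wL); apply: (Lmax w wL).2 (yz _ xy0); first by case: zmax.
  by move=> a aw; apply: contrapT => az; apply: nex; exists a.
have [b bm bz] : exists2 b, b \in m & b *: z <> 0.
  apply: contrapT => nex; apply: zmax.1; apply: socV => b bm.
  by apply: contrapT => bz; apply: nex; exists b.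
(* On each [w] the new element acts as [x], since [a] kills [w]; on [z] it acts as [a * b], nonzero
   by primality. *)
apply: (IH (z :: L) _ _ (x + a * b)) => //.
- exists z => // Lz; apply: az; move: z Lz {zmax yz bz}; apply: span_min => //.
  split=> [|c u v au av]; first exact: scaler0.
  by rewrite scalerDr scalerA mulrC -scalerA au av scaler0 addr0.
- by move=> w; rewrite inE => /orP[/eqP->|/Lmax].
- by rewrite rpredD // idealMr.
move=> w; rewrite inE scalerDl => /orP[/eqP->|wL].
  by rewrite yz // add0r => /(maximal_ann_prime zmax)[].
by rewrite mulrC -[(b * a) *: w]scalerA aL // scaler0 addr0; apply: xL.
Qed.

End MaximalAnnihilators.

(** * Ext *)

Section FreeModules.
Variables (R : comNzRingType) (N V : lmodType R).

Definition basis_elt (x : N) : free_mod N := (mkmalgU x 1 : {malg R[N]}).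

Lemma free_mod_ext (f g : {linear free_mod N -> V}) :
  (forall x, f (basis_elt x) = g (basis_elt x)) -> f =1 g.
Proof.
move=> fg u; have -> : u = \sum_(x <- msupp u) u@_x *: basis_elt x.
  rewrite {1}[u]monalgE; apply: eq_bigr => x _.
  by apply/malgP=> y; rewrite mcoeffU (mcoeffZ u@_x) mcoeffU mulr_natr.
by rewrite !linear_sum; apply: eq_bigr => x _; rewrite !linearZ fg.
Qed.

Lemma free_mod_map (phi : N -> V) :
  exists f : {linear free_mod N -> V}, forall x, f (basis_elt x) = phi x.
Proof.
pose f (g : free_mod N) : V := \sum_(x <- msupp g) g@_x *: phi x.
have fEw (g : free_mod N) (D : {fset N}) :
    (msupp g `<=` D)%fset -> f g = \sum_(x <- D) g@_x *: phi x.
  move=> gD; rewrite [LHS](big_fset_incl _ gD) // => x _ /mcoeff_outdom ->.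
  exact: scale0r.
have [|h hE] := @linear_exists _ _ _ f; last first.
  by exists h => x; rewrite hE (fEw _ _ msuppU_le) big_seq_fset1 mcoeffUU scale1r.
move=> a g h; pose D := (msupp g `|` msupp h `|` msupp (a *: g + h))%fset.
rewrite (@fEw (a *: g + h) D) ?fsubsetUr //.
rewrite (@fEw g D); last by rewrite /D -fsetUA fsubsetUl.
rewrite (@fEw h D); last by rewrite /D fsetUAC fsubsetUr.
rewrite scaler_sumr -big_split /=; apply: eq_bigr => x _.
by rewrite mcoeffD mcoeffZ scalerDl scalerA.
Qed.

End FreeModules.

Lemma free_mod_lift (R : comNzRingType) (N V W : lmodType R)
    (p : {linear V -> W}) (f : {linear free_mod N -> W}) :
  (forall g, exists v, p v = f g) ->
  exists f' : {linear free_mod N -> V}, forall g, p (f' g) = f g.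
Proof.
move=> fp; have [phi phiE] := choice (fun x => fp (basis_elt x)).
have [f' f'E] := free_mod_map phi.
exists f' => g; rewrite -[LHS]/((p \o f') g); apply: free_mod_ext => x /=.
by rewrite f'E phiE.
Qed.


Section ExtLemmas.
Variable R : comNzRingType.

Lemma Ext_trivialP i (N M : lmodType R) : trivial_module (Ext i N M) <->
  forall f : {linear res N i -> M}, (forall g, f (res_d g) = 0) -> is_coboundary f.
Proof.
split=> [E0 f fd|E0 u].
  have cf : (f : res N i -> M) \in @cocycle R N M i.
    by apply/asboolP; split=> //; apply: linearP.
  by have /quotmod_eq0/asboolP := E0 (quotmod_pi _ (Submod cf)).
have [[f cf] ->] := quotmod_surj u; apply/quotmod_eq0/asboolP => /=.
have /asboolP[lf fd] := cf; have [f' f'E] := linear_exists lf.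
by have <- : f' = f :> (_ -> _); [apply/funext|apply: E0 => g; rewrite f'E].
Qed.

Lemma res_dd (N : lmodType R) i (g : res N i.+2) : res_d (res_d g) = 0.
Proof.
rewrite {1}/res_d; have -> : counit (res_d g) = 0 by apply/res_exact; exists g.
by [].
Qed.

(** The piece of the long exact sequence of [0 -> V -> V -> W -> 0] needed here, by a chase: a
    cocycle [f] lifts to [F] with coboundary [x G]; since [G] is a coboundary of [H], [F - x H] is a
    cocycle lifting [f]. *)
Lemma Ext_reg_quot (N V W : lmodType R) (x : R) (p : {linear V -> W}) i :
  (forall w, exists v, p v = w) ->
  (forall v : V, p v = 0 <-> exists u : V, v = x *: u) ->
  (forall v : V, x *: v = 0 -> v = 0) ->
  trivial_module (Ext i N V) -> trivial_module (Ext i.+1 N V) ->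
  trivial_module (Ext i N W).
Proof.
move=> psurj pker xreg /Ext_trivialP E0 /Ext_trivialP E1; apply/Ext_trivialP => f fd.
have [F FE] := free_mod_lift (fun g => psurj (f g)).
have [G GE] := choice (fun g => (pker (F (res_d g))).1 (etrans (FE _) (fd g))).
have xinj (u v : V) : x *: u = x *: v -> u = v.
  move=> uv; apply/eqP; rewrite -subr_eq0; apply/eqP/xreg.
  by rewrite scalerBr uv subrr.
have [G' G'E] : exists G' : {linear res N i.+1 -> V}, G' =1 G.
  apply: linear_exists => a g h; apply: xinj.
  by rewrite scalerDr scalerA [x * a]mulrC -scalerA -!GE !linearP.
have [|H HE] := E1 G'.
  by move=> g; rewrite G'E; apply: xreg; rewrite -GE res_dd linear0.
have xH g : p (x *: H g) = 0 by apply/pker; exists (H g).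
have [K KE] : exists K : {linear res N i -> V}, forall g, K g = F g - x *: H g.
  by exists (F \- (x \*: H)).
have pK g : p (K g) = f g by rewrite KE linearB xH subr0 FE.
have /E0 : forall g, K (res_d g) = 0.
  by move=> g; rewrite KE -HE G'E -GE subrr.
clear -pK; case: i f K pK => [|i] f K pK /= => [K0 g|[k kE]].
  by rewrite -pK K0 linear0.
by exists (p \o k) => g; rewrite -pK kE.
Qed.

(* [tau] says that multiplication by [s] on [Y] factors through a free module;
   [rho] restricted to the kernel says the same of the next syzygy. *)
Lemma counit_lift_step (Y : lmodType R) (s : R) (tau : {linear Y -> free_mod Y}) :
  (forall y, counit (tau y) = s *: y) ->
  exists rho : {linear free_mod Y -> free_mod (submod (lin_ker (@counit R Y)))},
    forall k, counit (rho (submod_val k)) = s *: k.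
Proof.
(* [r] takes values in the kernel of [counit] and is multiplication by [s] on that kernel. *)
move=> tauE; pose r g := s *: g - tau (counit g).
have rk g : r g \in lin_ker (@counit R Y).
  by rewrite unfold_in /r linearB linearZ /= tauE subrr.
have [|r' r'E] := @linear_exists _ _ _ (fun g => Submod (rk g)).
  move=> a g h; apply: val_inj => /=; rewrite /r !linearP /=.
  by rewrite !scalerA mulrC addrACA.
have [rho rhoE] := free_mod_lift (fun g => @counit_surj R _ (r' g)).
exists rho => -[k kK]; rewrite rhoE r'E; apply: val_inj; rewrite /= /r.
by move/eqP: kK => ->; rewrite linear0 subr0.
Qed.

Lemma syz_homotopy (N : lmodType R) (s : R) j : (forall x : N, s *: x = 0) ->
  exists rho : {linear res N j -> res N j.+1},
    forall y : syz N j.+1, counit (rho (submod_val y)) = s *: y.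
Proof.
move=> sN0; suff [tau /counit_lift_step] : exists tau : {linear syz N j -> res N j},
  forall y, counit (tau y) = s *: y by [].
elim: j => [|j [tau /counit_lift_step[rho rhoE]]].
  (* The zeroth syzygy is [N] itself, where [s] acts as zero. *)
  by exists (\0 : {linear _ -> _}) => y; rewrite linear0 sN0.
have [|v vE] := @linear_exists R (syz N j.+1) (res N j) (@submod_val _ _ _) => //.
by exists (rho \o v) => y; rewrite /= vE rhoE.
Qed.

(** Multiplication by [s] on [Ext] is zero through [N] and bijective through [M]. *)
Lemma Ext_bijective_vanish (N M : lmodType R) (s : R) i :
  (forall x : N, s *: x = 0) -> (forall y : M, s *: y = 0 -> y = 0) ->
  (forall y : M, exists z, y = s *: z) -> trivial_module (Ext i N M).
Proof.
move=> sN0 sinj ssurj.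
have sI (y y' : M) : s *: y = s *: y' :> M -> y = y'.
  move=> yy; apply/eqP; rewrite -subr_eq0; apply/eqP/sinj.
  by rewrite scalerBr yy subrr.
(* [s] is null-homotopic on the resolution, since it lifts [0] on [N]. *)
apply/Ext_trivialP => f fd.
(* By exactness the kernel of [counit] consists of boundaries, on which a cocycle vanishes. *)
have fker g g' : counit g = counit g' -> f g = f g'.
  move=> gg; apply/eqP; rewrite -subr_eq0 -linearB; apply/eqP.
  have /res_exact[h ->] : counit (g - g') = 0 by rewrite linearB /= gg subrr.
  exact: fd.
case: i f fd fker => [|i] f fd fker /=.
  move=> g; apply: sinj; rewrite -linearZ -(linear0 f); apply: fker.
  by rewrite linear0 linearZ /= sN0.
have [rho rhoE] := syz_homotopy i sN0.
have [d dE] := choice ssurj.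
have [d' d'E] : exists d' : {linear M -> M}, d' =1 d.
  apply: linear_exists => a y z; apply: sI.
  by rewrite -dE scalerDr scalerA mulrC -scalerA -!dE.
(* [d'] divides by [s] on [M]. After multiplying by [s], the claim compares [f] at [s g] and at
   [rho (res_d g)], which have the same [counit]. *)
exists (d' \o f \o rho) => g /=; apply: sI; rewrite d'E -dE -linearZ.
by apply: fker; rewrite linearZ /= -rhoE.
Qed.

(** [Ext 0] is [Hom], and a map from [R/m] to [M] amounts to an element of [M] killed by [m]. *)
Lemma Ext0_residueP (m : idealr R) (M : lmodType R) :
  trivial_module (Ext 0 (residue m) M) <->
  forall y : M, (forall a, a \in m -> a *: y = 0) -> y = 0.
Proof.
split=> [/Ext_trivialP E0 y my|socM].
  have rE (a b : R) :
      quotmod_pi (idealr_submod m) a = quotmod_pi (idealr_submod m) b :> residue m ->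
      a *: y = b *: y.
    move=> /quotmod_eqE ab; apply/eqP; rewrite -subr_eq0 -scalerBl; apply/eqP.
    exact: my.
  have [r rP] := choice (@quotmod_surj R R^o (idealr_submod m)).
  (* This cocycle is the map sending the class of [1] to [y]; by [rE] the chosen representatives [r]
     do not matter. *)
  have [|f fE] := @linear_exists _ _ _ (fun g : res (residue m) 0 => (r (counit g) : R) *: y).
    move=> a g h; rewrite scalerA -scalerDl; apply: rE.
    by rewrite -rP !linearP /= -!rP.
  have f1 : f =1 fun=> 0.
    apply: E0 => g; rewrite fE.
    have -> : counit (res_d g) = 0 by apply/res_exact; exists g.
    rewrite -(scale0r y); apply: rE; rewrite -rP.
    exact/esym/linear0.
  have [g gE] := @counit_surj R (residue m) (quotmod_pi (idealr_submod m) 1).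
  by rewrite -(f1 g) fE gE -{1}(scale1r y); apply: rE.
apply/Ext_trivialP => f fd g; apply: socM => a am.
have [x xE] := quotmod_surj (counit g).
have /res_exact[h hE] : counit (a *: g) = 0.
  rewrite linearZ /= xE -linearZ /=; apply/quotmod_eq0.
  by rewrite -[_ *: _]/(a * x) mulrC; apply: idealMr.
by rewrite -linearZ hE fd.
Qed.

End ExtLemmas.

(** * Depth and chains of primes *)

Section PrimeChains.
Variables (R : comNzRingType).
Implicit Types p q : prime_idealr R.

Definition strict_sub p q : Prop := {subset p <= q} /\ ~ {subset q <= p}.

(** Only the first [n] inclusions are constrained; the values beyond index [n] are arbitrary. *)
Definition chain_above q n : Prop :=
  exists p : nat -> prime_idealr R,
    p 0 = q /\ forall i, (i < n)%N -> strict_sub (p i) (p i.+1).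

Lemma chain_above_cons p q n : strict_sub p q -> chain_above q n -> chain_above p n.+1.
Proof.
move=> pq [c [c0 cS]]; exists (fun i => if i is j.+1 then c j else p); split=> //.
by case=> [_|i]; [rewrite c0|apply: cS].
Qed.

Lemma chain_above_prime_chain q n : chain_above q n -> prime_chain R n.
Proof.
move=> [c [_ cS]].
have c_mono i j : (i <= j)%N -> (j <= n)%N -> {subset c i <= c j}.
  elim: j => [|j IH]; first by rewrite leqn0 => /eqP-> _ x.
  rewrite leq_eqVlt => /orP[/eqP-> _ x|ij jn x xi] //.
  by apply: (cS j jn).1; apply: IH => //; apply: ltnW.
exists (fun i => c i) => i j ij; have jn : (j <= n)%N by rewrite -ltnS.
split; first exact: c_mono (ltnW ij) jn.
have [_ nsub] := cS i (leq_trans ij jn); move=> ji; apply: nsub => x xi.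
exact: ji _ (c_mono _ _ ij jn _ xi).
Qed.

End PrimeChains.

Section DepthBound.
Variables (R : comNzRingType) (m : idealr R).
Hypotheses (noeR : noetherian R) (locR : local_ring m).

(** Induction on [d], passing to [V / x V] for a regular [x] in [m]. An element [u] killed by [q]
    and outside [x V] has a nonzero class there; the prime [q'] obtained for it contains [q] and
    [x], while [x] is not in [q]. *)
Lemma chain_above_ann d (V : lmodType R) (z : V) : fin_gen V -> CohCM m d V -> z <> 0 ->
  exists2 q : prime_idealr R, forall a, a *: z = 0 -> a \in q & chain_above q d.
Proof.
elim: d V z => [|d IH] V z fgV cmV z0;
  have noeV := noetherian_fin_gen noeR fgV;
  have [w wmax zw] := maximal_ann_exists noeR z0;
  have [||q qE] := prime_idealr_exists (ann_submodule w).
1,4: by rewrite scale1r; case: wmax.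
1,3: by move=> a b; apply: maximal_ann_prime.
  by exists q => [a /zw/qE //|]; exists (fun=> q).
have /Ext0_residueP socV := cmV 0 (ltn0Sn d).
have [x xm xreg] := regular_element_exists noeR noeV socV.
(* Otherwise [U = {u | q u = 0}] would satisfy [U = x U], against Nakayama. *)
have [u uq ux] : exists2 u : V, (forall a, a \in q -> a *: u = 0) &
    ~ exists v, u = x *: v.
  apply: contrapT => nex.
  have div (u : V) : (forall a, a \in q -> a *: u = 0) ->
      exists2 v : V, (forall a, a \in q -> a *: v = 0) & u = x *: v.
    move=> uq; have [[v vE]|nv] := pselect (exists v, u = x *: v); last first.
      by case: nex; exists u.
    exists v => // a aq; apply: xreg.
    by rewrite scalerA mulrC -scalerA -vE uq.
  (* Take a maximal cyclic submodule [R v] of [U] above [R w]. Writing [v = x t] with [t] in [U],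
     maximality gives [t = a x t], and [1 - a x] is a unit, so [t], [v] and [w] vanish. *)
  pose F (Q : V -> Prop) := exists2 v : V,
    (forall a, a \in q -> a *: v = 0) & Q = (fun y => exists a, y = a *: v).
  have [||Q [[v vq ->] wQ vmax]] := @maximal_submodule R V noeV F
      (fun y => exists a, y = a *: w).
  - move=> _ [v _ ->]; split=> [|a _ _ [b ->] [c ->]]; first by exists 0; rewrite scale0r.
    by exists (a * b + c); rewrite scalerDl scalerA.
  - by exists w => // a /qE.
  have [t tq tE] := div v vq.
  have [|_ [b ->]||a aE] := vmax (fun y => exists a, y = a *: t) _ _ t.
  - by exists t.
  - by exists (b * x); rewrite tE scalerA.
  - by exists 1; rewrite scale1r.
  have [|c cE] := local_unit noeR locR (a := 1 - a * x).
    apply: contraFN (idealr1 m) => axm.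
    by rewrite -(subrK (a * x) 1) rpredD // idealMr.
  have t0 : t = 0.
    by rewrite -(scale1r t) -cE -scalerA scalerBl scale1r -scalerA -tE -aE subrr scaler0.
  have [|b] := wQ w; first by exists 1; rewrite scale1r.
  by rewrite tE t0 !scaler0; case: wmax.
pose xV (v : V) := exists t, v = x *: t.
have hxV : submoduleP xV.
  split=> [|a _ _ [t ->] [t' ->]]; first by exists 0; rewrite scaler0.
  by exists (a *: t + t'); rewrite scalerDr !scalerA mulrC.
have [S SE] := submod_exists hxV.
have fgW : fin_gen (quotmod S : lmodType R).
  have [n [e eV]] := fgV; exists n, (fun i => quotmod_pi S (e i)) => y.
  have [v ->] := quotmod_surj y; have [c ->] := eV v.
  by exists c; rewrite linear_sum; apply: eq_bigr => i _; rewrite linearZ.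
have cmW : CohCM m d (quotmod S).
  move=> i id; apply: (@Ext_reg_quot R _ V _ x (quotmod_pi S)) => //.
  - by move=> y; have [v ->] := quotmod_surj y; exists v.
  - by move=> v; rewrite quotmod_eq0 SE.
  - by apply: cmV; apply: ltnW.
  exact: cmV.
have [|q' q'E q'd] := IH _ (quotmod_pi S u) fgW cmW; first by move=> /quotmod_eq0/SE.
exists q => [a /zw/qE //|]; apply: chain_above_cons q'd; split=> [a aq|qq].
  by apply: q'E; rewrite -linearZ uq // linear0.
have /qq/qE/xreg : x \in q'.
  by apply: q'E; rewrite -linearZ; apply/quotmod_eq0/SE; exists u.
by case: wmax.
Qed.

End DepthBound.

(** * Direct limits *)

Section ProductModule.
Variables (R : nzRingType) (I : Type) (M : I -> lmodType R).

Definition prod_mod : Type := forall i, M i.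

HB.instance Definition _ := gen_eqMixin prod_mod.
HB.instance Definition _ := gen_choiceMixin prod_mod.

Implicit Types f g h : prod_mod.

Let add f g : prod_mod := fun i => f i + g i.
Let opp f : prod_mod := fun i => - f i.
Let zero : prod_mod := fun i => 0.
Let scale a f : prod_mod := fun i => a *: f i.

Fact prod_mod_addA : associative add.
Proof. by move=> f g h; apply: functional_extensionality_dep => i; apply: addrA. Qed.
Fact prod_mod_addC : commutative add.
Proof. by move=> f g; apply: functional_extensionality_dep => i; apply: addrC. Qed.
Fact prod_mod_add0 : left_id zero add.
Proof. by move=> f; apply: functional_extensionality_dep => i; apply: add0r. Qed.
Fact prod_mod_addN : left_inverse zero opp add.
Proof. by move=> f; apply: functional_extensionality_dep => i; apply: addNr. Qed.

HB.instance Definition _ := GRing.isZmodule.Build prod_mod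
  prod_mod_addA prod_mod_addC prod_mod_add0 prod_mod_addN.

Fact prod_mod_scaleA a b f : scale a (scale b f) = scale (a * b) f.
Proof. by apply: functional_extensionality_dep => i; apply: scalerA. Qed.
Fact prod_mod_scale1 : left_id 1 scale.
Proof. by move=> f; apply: functional_extensionality_dep => i; apply: scale1r. Qed.
Fact prod_mod_scaleDr : right_distributive scale +%R.
Proof. by move=> a f g; apply: functional_extensionality_dep => i; apply: scalerDr. Qed.
Fact prod_mod_scaleDl f : {morph scale^~ f : a b / a + b}.
Proof. by move=> a b; apply: functional_extensionality_dep => i; apply: scalerDl. Qed.

HB.instance Definition _ := GRing.Zmodule_isLmodule.Build R prod_mod
  prod_mod_scaleA prod_mod_scale1 prod_mod_scaleDr prod_mod_scaleDl.

End ProductModule.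

Section DirectLimits.
Variables (R : comNzRingType) (D : directed_system R) (M : lmodType R).
Variable u : forall i, {linear ds_module D i -> M}.
Hypothesis limu : is_direct_limit u.

(** The images form a submodule [S] by directedness; the projection to [M / S] and the zero map
    agree on them, so they are equal by uniqueness. *)
Lemma direct_limit_surj y : exists i x, u i x = y.
Proof.
have hP : submoduleP (fun y => exists i x, u i x = y).
  split=> [|a _ _ [i [x <-]] [j [z <-]]].
    by have [i] := ds_inhabited D; exists i, 0; rewrite linear0.
  have [k [ik jk]] := ds_directed i j.
  exists k, (a *: ds_map ik x + ds_map jk z).
  by rewrite linearP !limu.1.
have [S SE] := submod_exists hP.
have [|g [_ guniq]] := limu.2 (quotmod S) (fun i => \0 : {linear _ -> _}).
  by [].
have g0 : (\0 : {linear M -> quotmod S}) =1 g by apply: guniq.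
have gpi : quotmod_pi S =1 g.
  by apply: guniq => i x; apply/quotmod_eq0/SE; exists i, x.
by apply/SE/quotmod_eq0; rewrite gpi -g0.
Qed.

(* The maps [ds_module D i -> prod_j ds_module D j / (eventually zero families)]
   form a cocone. *)
Lemma direct_limit_eq0 i (x : ds_module D i) : u i x = 0 ->
  exists j (ij : ds_le i j), ds_map ij x = 0.
Proof.
pose ev (f : prod_mod (ds_module D)) := exists j, forall k, ds_le j k -> f k = 0.
have hev : submoduleP ev.
  split=> [|a f g [i1 f0] [i2 g0]].
    by have [j] := ds_inhabited D; exists j.
  have [j [i1j i2j]] := ds_directed i1 i2; exists j => k jk.
  rewrite -[LHS]/(a *: f k + g k) f0 ?g0 ?scaler0 ?addr0 //.
    exact: ds_trans i2j jk.
  exact: ds_trans i1j jk.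
have [S SE] := submod_exists hev.
(* The family of images of [x], with default value [0] at indices not above [i]; modulo eventually
   zero families the default is invisible. *)
pose ext i (x : ds_module D i) : prod_mod (ds_module D) :=
  fun k => if pselect (ds_le i k) is left ik then ds_map ik x else 0.
have extE i' k (ik : ds_le i' k) x' : @ext i' x' k = ds_map ik x'.
  by rewrite /ext; case: pselect => // ik'; rewrite (Prop_irrelevance ik' ik).
have ext_lin i' : linear (@ext i').
  move=> a y z; apply: functional_extensionality_dep => k.
  rewrite -[RHS]/(a *: ext _ y k + ext _ z k) /ext.
  by case: pselect => [ik|_]; rewrite ?linearP // scaler0 addr0.
have v_ex i' : exists w : {linear ds_module D i' -> quotmod S},
    forall y, w y = quotmod_pi S (ext i' y).
  by apply: linear_exists => a y z; rewrite ext_lin; apply: linearP.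
pose v i' : {linear ds_module D i' -> quotmod S} := projT1 (cid (v_ex i')).
have vE i' y : v i' y = quotmod_pi S (ext i' y) by rewrite /v; case: cid.
have [|g [gE _]] := limu.2 _ v.
  move=> i1 i2 i12 y; rewrite !vE; apply/quotmod_eqE/SE; exists i2 => k i2k.
  rewrite -[LHS]/(ext _ _ k - ext _ _ k) (extE _ _ i2k) (extE _ _ (ds_trans i12 i2k)).
  by rewrite (ds_map_comp _ _ (ds_trans i12 i2k)) subrr.
move=> ux0; have : v i x = 0 by rewrite -gE ux0 linear0.
rewrite vE => /quotmod_eq0/SE[j0 xj0].
have [j [ij j0j]] := ds_directed i j0.
by exists j, ij; rewrite -(extE _ _ ij) xj0.
Qed.

(** Each [a] in [J] costs one more transition map, after which it kills the chosen lift; finiteness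
    of [J] makes this terminate. *)
Lemma direct_limit_annihilated (J : seq R) y : (forall a, a \in J -> a *: y = 0) ->
  exists i x, u i x = y /\ forall a, a \in J -> a *: x = 0.
Proof.
elim: J => [_|a J IH Jy].
  by have [i [x xy]] := direct_limit_surj y; exists i, x.
have [|i [x [xy Jx]]] := IH; first by move=> b bJ; apply: Jy; rewrite inE bJ orbT.
have [|j [ij ax0]] := @direct_limit_eq0 i (a *: x).
  by rewrite linearZ /= xy Jy // mem_head.
exists j, (ds_map ij x); split=> [|b]; first by rewrite limu.1.
rewrite inE => /orP[/eqP->|bJ]; first by rewrite -linearZ.
by rewrite -linearZ /= Jx // linear0.
Qed.

End DirectLimits.

(** * A module as the direct limit of its finitely generated submodules *)

Section SpanUnion.
Variables (R : comNzRingType) (M : lmodType R).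

Definition span_pred (L : seq M) : {pred M} := fun x => `[< span L x >].

Fact span_pred_closed L : submod_closed (span_pred L).
Proof.
have [s0 sD] := span_submodule L.
by split=> [|a x y /asboolP Lx /asboolP Ly]; apply/asboolP; [|apply: sD].
Qed.

HB.instance Definition _ L :=
  GRing.isSubmodClosed.Build R M (span_pred L) (span_pred_closed L).

Definition span_mod L : lmodType R := submod (span_pred L).

Definition span_le (L L' : seq M) : Prop := forall x, span L x -> span L' x.

Fact span_le_mem L L' (LL' : span_le L L') (x : span_mod L) :
  submod_val x \in span_pred L'.
Proof. by case: x => x /= /asboolP/LL' L'x; apply/asboolP. Qed.

Definition span_incl L L' (LL' : span_le L L') (x : span_mod L) : span_mod L' :=
  Submod (span_le_mem LL' x).

Fact span_incl_linear L L' (LL' : span_le L L') : linear (span_incl LL').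
Proof. by move=> a x y; apply: val_inj. Qed.

HB.instance Definition _ L L' (LL' : span_le L L') :=
  GRing.isLinear.Build R (span_mod L) (span_mod L') _ (span_incl LL')
    (span_incl_linear LL').

Definition span_val L (x : span_mod L) : M := submod_val x.

Fact span_val_linear L : linear (@span_val L).
Proof. by []. Qed.

HB.instance Definition _ L :=
  GRing.isLinear.Build R (span_mod L) M _ (@span_val L) (@span_val_linear L).

Fact span_le_directed L L' : exists L'', span_le L L'' /\ span_le L' L''.
Proof.
exists (L ++ L'); split=> x; apply: span_sub => y yL; rewrite mem_cat yL //.
by rewrite orbT.
Qed.

Fact span_incl_id L (LL : span_le L L) (x : span_mod L) : span_incl LL x = x.
Proof. exact: val_inj. Qed.

Fact span_incl_comp L1 L2 L3 (L12 : span_le L1 L2) (L23 : span_le L2 L3)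
    (L13 : span_le L1 L3) (x : span_mod L1) :
  span_incl L23 (span_incl L12 x) = span_incl L13 x.
Proof. exact: val_inj. Qed.

Definition span_system : directed_system R :=
  @DirectedSystem R (seq M) span_le (inhabits [::]) (fun L x => id)
    (fun L1 L2 L3 L12 L23 x => L23 x \o L12 x) span_le_directed
    span_mod (fun L L' LL' => span_incl LL') span_incl_id span_incl_comp.

Lemma span_mod_fin_gen L : fin_gen (span_mod L).
Proof.
have memL (i : 'I_(size L)) : L`_i \in span_pred L.
  by apply/asboolP/span_mem/mem_nth.
exists (size L), (fun i => Submod (memL i)) => -[x xL].
have /asboolP/spanP[c xE] := xL; exists c; apply: val_inj.
by rewrite -[RHS]/(span_val _) linear_sum.
Qed.

Lemma span_system_limit :
  is_direct_limit (fun L : ds_index span_system =>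
    @span_val L : {linear ds_module span_system L -> M}).
Proof.
split=> // N v vc.
have memL (L : seq M) x : x \in L -> x \in span_pred L.
  by move=> xL; apply/asboolP/span_mem.
have mem1 x : x \in span_pred [:: x] by apply/memL/mem_head.
(* The cocone assigns [x] a value independent of the list, so the singleton [[:: x]] can define the
   induced map. *)
have vE (L L' : seq M) x (xL : x \in span_pred L) (xL' : x \in span_pred L') :
    v L (Submod xL) = v L' (Submod xL').
  have [L'' [LL'' L'L'']] := span_le_directed L L'.
  rewrite -(vc _ _ LL'') -(vc _ _ L'L''); congr (v _ _).
  exact: val_inj.
have [|g gE] := @linear_exists R M N (fun x => v [:: x] (Submod (mem1 x))).
  move=> a x y.
  have xL : x \in span_pred [:: x; y] by apply/memL/mem_head.
  have yL : y \in span_pred [:: x; y] by apply/memL; rewrite !inE eqxx orbT.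
  have aL : a *: x + y \in span_pred [:: x; y] by rewrite rpredD // rpredZ.
  rewrite (vE _ _ _ _ xL) (vE _ _ _ (mem1 y) yL) (vE _ _ _ _ aL) -linearP.
  by congr (v _ _); apply: val_inj.
exists g; split=> [L [x xL]|h hE x]; first by rewrite gE; apply: vE.
by rewrite gE -hE.
Qed.

End SpanUnion.

(** * Inverting an element modulo a prime *)

Section Localization.
Variables (R : comNzRingType) (p : prime_idealr R) (s : R).
Hypothesis sp : s \notin p.

(* [M] is [R[T] / (p R[T] + (s T - 1))], that is [(R / p)[1 / s]]. *)
Lemma prime_localization_exists : exists M : lmodType R,
  [/\ forall y : M, s *: y = 0 -> y = 0, forall y : M, exists z, y = s *: z
    & exists2 y : M, y <> 0 & forall a, a \in p -> a *: y = 0].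
Proof.
pose P (h : {poly R}) := exists f g : {poly R},
  (forall i, f`_i \in p) /\ h = f + (s *: ('X * g) - g).
have hP : submoduleP P.
  split=> [|a _ _ [f [g [fp ->]]] [f' [g' [f'p ->]]]].
    by exists 0, 0; split=> [i|]; rewrite ?coef0 ?rpred0 // mulr0 scaler0 subrr addr0.
  exists (a *: f + f'), (a *: g + g'); split=> [i|].
    by rewrite coefD coefZ rpredD // idealMr.
  rewrite mulrDr -scalerAr !scalerDr scalerN !scalerA [s * a]mulrC opprD.
  by rewrite addrACA; congr (_ + _); rewrite addrACA.
have [S SE] := submod_exists hP.
have shift (h : {poly R}) : s *: ('X * h) - h \in S.
  by apply/SE; exists 0, h; rewrite add0r; split=> // i; rewrite coef0 rpred0.
exists (quotmod S); split=> [y|y|].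
- have [h ->] := quotmod_surj y; rewrite -linearZ => /quotmod_eq0/SE[f [g [fp hE]]].
  (* If [s h] lies in the ideal, so does ['X] times it, and [h] differs from that by a multiple of
     [s 'X - 1]. *)
  have hX : h = s *: ('X * h) - (s *: ('X * h) - h) by rewrite subKr.
  apply/quotmod_eq0/SE; rewrite hX; apply: (submoduleB hP); last exact/SE.
  rewrite scalerAr hE; exists ('X * f), ('X * g); split=> [i|].
    by rewrite coefXM; case: (i) => [|j]; rewrite /= ?rpred0.
  by rewrite mulrDr mulrBr -scalerAr.
- have [h ->] := quotmod_surj y; exists (quotmod_pi S ('X * h)).
  by rewrite -linearZ; apply/esym/quotmod_eqE.
exists (quotmod_pi S 1) => [/quotmod_eq0/SE[f [g [fp gE]]]|a ap]; last first.
  rewrite -linearZ; apply/quotmod_eq0/SE; exists (a *: 1), 0.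
  split=> [i|]; last by rewrite mulr0 scaler0 subrr addr0.
  by rewrite coefZ mulrC idealMr.
(* Comparing coefficients in [1 = f + s 'X g - g] modulo [p]. At [n = size g] the coefficient of [g]
   is zero, which puts a power of [s] in [p]. *)
have gp n : g`_n + s ^+ n \in p.
  elim: n => [|n IH].
    have := congr1 (coefp 0) gE; rewrite /= coefD coefB coefZ coefXM coef1 => g0.
    by rewrite expr0 -[1]/((0%N == 0)%:R) g0 mulr0 sub0r addrC subrK.
  have /(congr1 (fun q : {poly R} => q`_n.+1)) := gE.
  rewrite coefD coefB coefZ coefXM coef1 /= => /esym/eqP.
  rewrite addrA subr_eq0 => /eqP <-.
  by rewrite -addrA exprS -mulrDr rpredD // idealMr.
have : s ^+ size g \in p by have := gp (size g); rewrite nth_default // add0r.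
elim: (size g) => [|n IH]; first by rewrite expr0 idealr1.
by rewrite exprS prime_idealrM (negbTE sp).
Qed.

End Localization.

(** * Comparison of the two classes *)

Section LimitsOfCMModules.
Variables (R : comNzRingType) (m : idealr R).
Hypotheses (noeR : noetherian R) (locR : local_ring m).

(** Reduces annihilation by [I] to finitely many equations, which can be lifted through a direct
    limit. *)
Lemma ideal_gens (I : idealr R) : exists2 J : seq R, {subset J <= I} &
  forall (V : lmodType R) (y : V), (forall a, a \in J -> a *: y = 0) ->
    forall a, a \in I -> a *: y = 0.
Proof.
have hI : @submoduleP R R^o (fun a => a \in I).
  split=> [|a b c bI cI]; first exact: idealr0.
  by rewrite rpredD // idealMr.
have [J JI IJ] := noetherianP noeR hI.
exists J => // V y Jy a /IJ; exact: (span_min (ann_submodule y)).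
Qed.

Lemma lim_CM_annihilated d (I : idealr R) (M : lmodType R) (y : M) :
  lim_CM m d M -> y <> 0 -> (forall a, a \in I -> a *: y = 0) ->
  exists (N : lmodType R) (z : N),
    [/\ CM m d N, z <> 0 & forall a, a \in I -> a *: z = 0].
Proof.
move=> [D [u [limu cmD]]] y0 Iy; have [J JI IJ] := ideal_gens I.
have [i [z [zy Jz]]] := direct_limit_annihilated limu (fun a aJ => Iy a (JI a aJ)).
exists (ds_module D i), z; split; [exact: cmD| |exact: IJ].
by move=> z0; apply: y0; rewrite -zy z0 linear0.
Qed.

Lemma lim_CM_dim1 (M : lmodType R) : lim_CM m 1 M <-> CohCM m 1 M.
Proof.
split=> [limM [] // _|cmM]; first apply/Ext0_residueP.
  move=> y my; apply: contrapT => y0.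
  have [N [z [[_ cmN] z0 mz]]] := lim_CM_annihilated limM y0 my.
  by apply: z0; have /Ext0_residueP := cmN 0 isT; apply.
exists (span_system M), (@span_val R M); split; first exact: span_system_limit.
move=> L; split; first exact: span_mod_fin_gen.
case=> // _; apply/Ext0_residueP => x mx; apply: val_inj.
have /Ext0_residueP := cmM 0 isT; apply => a am.
by rewrite -[RHS](linear0 (@span_val R M L)) -(mx a am) linearZ.
Qed.

Lemma CohCM_not_lim_CM d : krull_dim R d -> (1 < d)%N ->
  exists M : lmodType R, CohCM m d M /\ ~ lim_CM m d M.
Proof.
move=> [[P Pchain] dmax] d_gt1.
have lt i : (i <= 2)%N -> (i < d.+1)%N by move=> i2; apply: leq_trans d_gt1.
pose p i (i2 : (i <= 2)%N) := P (Ordinal (lt i i2)).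
pose p0 := p 0 isT; pose p1 := p 1 isT; pose p2 := p 2 isT.
have p01 : strict_sub p0 p1 by apply: Pchain.
have [_ p21] : strict_sub p1 p2 by apply: Pchain.
have [s sp2 sp1] : exists2 s, s \in p2 & s \notin p1.
  apply: contrapT => nex; apply: p21 => s sp2; apply: contraT => sp1.
  by case: nex; exists s.
have sm := idealr_sub_local noeR locR sp2.
have [M [sinj ssurj [y y0 p1y]]] := prime_localization_exists sp1.
exists M; split=> [i _|limM].
  apply: (@Ext_bijective_vanish R _ M s) => // x.
  have [a ->] := quotmod_surj x; rewrite -linearZ; apply/quotmod_eq0.
  by rewrite -[_ *: _]/(s * a) mulrC; apply: idealMr.
have [N [z [[fgN cmN] z0 p1z]]] := lim_CM_annihilated limM y0 p1y.
have [q zq qchain] := chain_above_ann noeR locR fgN cmN z0.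
(* [q] contains [p1], because [p1] kills [z]. *)
have p0q : strict_sub p0 q.
  split=> [a /p01.1/p1z/zq //|qp0]; apply: p01.2 => a /p1z/zq; exact: qp0.
have /chain_above_prime_chain/dmax := chain_above_cons p0q qchain.
by rewrite ltnn.
Qed.

End LimitsOfCMModules.

Local Close Scope ring_scope.

(** For [d = 0] the Ext condition is empty and both classes contain every module, so the equivalence
    is stated for positive [d]. *)
Theorem theorem3p8 (R : comNzRingType) (m : idealr R) (d : nat)
    (hR : CM_local_ring m d) :
  (d = 1 -> forall M : lmodType R, lim_CM m d M <-> CohCM m d M) /\
  (0 < d -> (exists Omega : lmodType R, canonical_module m d Omega) ->
    ((forall M : lmodType R, lim_CM m d M <-> CohCM m d M) <-> d = 1)).
Proof.
have [noeR locR dimR _] := hR.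
have dim1 : d = 1 -> forall M : lmodType R, lim_CM m d M <-> CohCM m d M.
  by move=> -> M; apply: lim_CM_dim1.
split=> // d_gt0 _; split=> // limE; apply: contrapT => d1.
have [|M [cmM]] := CohCM_not_lim_CM noeR locR dimR; last by apply; apply/limE.
by rewrite ltn_neqAle d_gt0 eq_sym andbT; apply/eqP.
Qed.
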